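(* Let $q$ be a prime power and $A=\mathbb{F}_q[T]$. For $i\ge-1$ define polynomials $u_i(s)\in A[s]$ recursively by $u_{-1}(s)=0$, $u_0(s)=1$ and, for $i\ge 0$, $$u_{i+1}(s)=(s+T^q)^{q^i}u_i(s)-(T^{q^i}-T)s^{q^i}u_{i-1}(s).$$ Let $p(T)\in A$ be an irreducible polynomial of degree $d$ with $\langle p(T)\rangle\neq\langle T\rangle$. Then $$h_{p(T)}(s)=u_d^{(p(T))}(s),$$ where $h_{p(T)}(s)$ is the Deuring polynomial characterising supersingular $\Delta$-invariants in $A$-characteristic $p(T)$ and $u_d^{(p(T))}(s)$ denotes the reduction of $u_d(s)$ modulo $p(T)$.
   Context: Let $L$ be an algebraic closure of $A/\langle p(T)\rangle$ and $\gamma:A\to A/\langle p(T)\rangle\subset L$ the natural homomorphism. Let $\tau$ be the $q$-power Frobenius; $L\{\tau\}$ is the twisted polynomial ring with $\tau c=c^q\tau$, and $\sum c_k\tau^k$ acts on $L$ by $x\mapsto\sum c_kx^{q^k}$. A rank $2$ Drinfeld $A$-module $\psi$ over $L$ is an $\mathbb{F}_q$-algebra homomorphism $A\to L\{\tau\}$, $a\mapsto\psi_a$, determined by $\psi_T=\Delta\tau^2+g\tau+\gamma(T)$ with $\Delta\neq0$. It is supersingular if $\psi[p(T)]=\{x\in L:\psi_{p(T)}(x)=0\}$ is $\{0\}$ (equivalently, the coefficient of $\tau^d$ in $\psi_{p(T)}$ is zero, where $d=\deg p(T)$). For $\Delta\in L\setminus\{0\}$ let $\psi^\Delta$ be the Drinfeld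 module with $$\psi^\Delta_T=\Delta\tau^2-(\Delta+\gamma(T))\tau+\gamma(T)=(\Delta\tau-\gamma(T))(\tau-1).$$ The Deuring polynomial is $h_{p(T)}(s)=\prod(s-\Delta)$, the product being over all $\Delta\in L\setminus\{0\}$ such that $\psi^\Delta$ is supersingular. Reduction modulo $p(T)$ means applying $A\to A/\langle p(T)\rangle\subset L$ to the coefficients; the asserted equality is in $L[s]$. *)

(* Defs.v *)
From HB Require Import structures.
From mathcomp Require Import all_boot all_order all_fingroup all_solvable.
From mathcomp Require Import all_algebra all_field.
From mathcomp Require Import boolp classical_sets cardinality fsbigop.

Set Implicit Arguments.
Unset Strict Implicit.
Unset Printing Implicit Defensive.

Import GRing.Theory.
Local Open Scope ring_scope.

(* Throughout, q = #|F|, A = {poly F}, and gamma : A -> L is the structure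
   morphism; F acts on L through the constants of A. *)

(* L is an algebraic closure of A / <p>: the morphism gamma factors through an
   embedding of A / <p> into L exactly when its kernel is <p>. Since gamma may
   kill nonzero coefficients, it is the image of P in L[x] that must be
   nonzero. *)
Definition algebraic_closure_mod (F : finFieldType) (p : {poly F})
    (L : closedFieldType) (gamma : {rmorphism {poly F} -> L}) : Prop :=
  (forall a : {poly F}, (gamma a == 0) = (p %| a)) /\
  (forall x : L, exists P : {poly {poly F}},
     map_poly gamma P != 0 /\ root (map_poly gamma P) x).

Section TwistedPolynomials.

Variables (F : finFieldType) (L : fieldType).
Variable gamma : {rmorphism {poly F} -> L}.

(* gamma is only used to know that L has characteristic dividing q. *)
Definition frobq of {rmorphism {poly F} -> L} := fun (i : nat) (x : L) =>
  x ^+ (#|F| ^ i)%N.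

Lemma pnat_frobq i : [pchar L].-nat (#|F| ^ i)%N.
Proof.
have [r r_pr rF] := finPcharP F.
have rL : r \in [pchar L].
  by apply: (rmorph_pchar gamma); apply: (rmorph_pchar (@polyC F)).
rewrite pnatX; apply/orP; left; rewrite (eq_pnat _ (pcharf_eq rL)).
by rewrite (card_pprimeChar rF) pnatX pnat_id.
Qed.

Fact frobq_is_nmod_morphism i : nmod_morphism (frobq gamma i).
Proof.
split=> [|x y]; rewrite /frobq.
  by rewrite expr0n expn_eq0 (gtn_eqF (ltnW (finNzRing_gt1 F))).
exact: (exprDn_pchar x y (pnat_frobq i)).
Qed.

Fact frobq_is_monoid_morphism i : monoid_morphism (frobq gamma i).
Proof. by split=> [|x y]; rewrite /frobq ?expr1n ?exprMn. Qed.

HB.instance Definition _ i :=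
  GRing.isNmodMorphism.Build L L (frobq gamma i) (frobq_is_nmod_morphism i).
HB.instance Definition _ i :=
  GRing.isMonoidMorphism.Build L L (frobq gamma i) (frobq_is_monoid_morphism i).

Lemma frobqD i j x : frobq gamma i (frobq gamma j x) = frobq gamma (i + j) x.
Proof. by rewrite /frobq -exprM -expnD addnC. Qed.

(* The ring L{tau}: the polynomial \sum_k c_k 'X^k stands for
   \sum_k c_k tau^k. *)
Definition tpoly of {rmorphism {poly F} -> L} : Type := {poly L}.

HB.instance Definition _ := GRing.Zmodule.copy (tpoly gamma) {poly L}.

(* tau^i g = g^(q^i) tau^i, where g^(q^i) is g with its coefficients raised to
   the power q^i. *)
Definition tmul (f g : {poly L}) : {poly L} :=
  \sum_(i < size f) f`_i *: (map_poly (frobq gamma i) g * 'X^i).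

Lemma tmulE N (f g : {poly L}) : (size f <= N)%N ->
  tmul f g = \sum_(i < N) f`_i *: (map_poly (frobq gamma i) g * 'X^i).
Proof.
move=> leN; rewrite /tmul.
rewrite (big_ord_widen _ (fun i => f`_i *: (map_poly (frobq gamma i) g * 'X^i))
  leN) big_mkcond /=.
apply: eq_bigr => i _; case: ltnP => // /(nth_default 0) ->.
by rewrite scale0r.
Qed.

Lemma tmulDl : left_distributive tmul +%R.
Proof.
move=> f g h; pose N := maxn (size f) (size g).
rewrite (@tmulE N (f + g)) ?size_polyD // (@tmulE N f) ?leq_maxl //.
rewrite (@tmulE N g) ?leq_maxr // -big_split /=.
by apply: eq_bigr => i _; rewrite coefD scalerDl.
Qed.

Lemma tmulDr : right_distributive tmul +%R.
Proof.
move=> f g h; rewrite /tmul -big_split /=.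
by apply: eq_bigr => i _; rewrite rmorphD mulrDl scalerDr.
Qed.

Lemma tmul1l : left_id 1 tmul.
Proof.
move=> f; rewrite /tmul size_poly1 big_ord1 coef1 scale1r mulr1.
by apply/polyP=> k; rewrite coef_map /= /frobq expn0 expr1.
Qed.

Lemma tmul1r : right_id 1 tmul.
Proof.
move=> f; rewrite /tmul -[RHS]coefK poly_def.
by apply: eq_bigr => i _; rewrite rmorph1 mul1r.
Qed.

Lemma tmul_suml (I : finType) (G : I -> {poly L}) h :
  tmul (\sum_i G i) h = \sum_i tmul (G i) h.
Proof.
have t0 : tmul 0 h = 0 by rewrite /tmul size_poly0 big_ord0.
by apply: (big_morph (tmul^~ h) _ t0) => x y; rewrite tmulDl.
Qed.

Lemma tmulA : associative tmul.
Proof.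
move=> f g h; rewrite [X in _ = tmul X _]/tmul tmul_suml {1}/tmul.
apply: eq_bigr => i _; set c := f`_i.
have sz : (size (c *: (map_poly (frobq gamma i) g * 'X^i))
           <= i + size g)%N.
  apply: leq_trans (size_scale_leq _ _) _.
  apply: leq_trans (size_polyMleq _ _) _.
  by rewrite size_polyXn addnS /= addnC leq_add2l size_poly.
rewrite (tmulE _ sz) big_split_ord /= big1 ?add0r; last first.
  by move=> k _; rewrite coefZ coefMXn ltn_ord mulr0 scale0r.
rewrite rmorph_sum /= mulr_suml scaler_sumr; apply: eq_bigr => j _.
rewrite coefZ coefMXn ltnNge leq_addr /= addKn coef_map -scalerA.
rewrite map_polyZ rmorphM /= map_polyXn -scalerAl -mulrA -exprD addnC.
congr (_ *: (_ *: (_ * _))).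
by apply/polyP=> k; rewrite !coef_map /= frobqD addnC.
Qed.

Fact toner_neq0 : (1 : {poly L}) != 0. Proof. exact: oner_neq0. Qed.

HB.instance Definition _ := GRing.Zmodule_isNzRing.Build (tpoly gamma)
  tmulA tmul1l tmul1r tmulDl tmulDr toner_neq0.

Definition tau : tpoly gamma := 'X : {poly L}.

Definition tconst (c : L) : tpoly gamma := (c%:P : {poly L}).

Fact tconst_is_nmod_morphism : nmod_morphism tconst.
Proof. by split=> [|x y]; [exact: polyC0 | exact: polyCD]. Qed.

Fact tconst_is_monoid_morphism : monoid_morphism tconst.
Proof.
split=> [//|x y].
change (tconst (x * y) = tmul x%:P y%:P); rewrite /tconst.
rewrite (@tmulE 1) ?size_polyC_leq1 // big_ord1 coefC /= mulr1.
by rewrite map_polyC /= /frobq expn0 expr1 polyCM mul_polyC.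
Qed.

HB.instance Definition _ :=
  GRing.isNmodMorphism.Build L (tpoly gamma) tconst tconst_is_nmod_morphism.
HB.instance Definition _ :=
  GRing.isMonoidMorphism.Build L (tpoly gamma) tconst tconst_is_monoid_morphism.

Lemma tau_const (c : L) : tau * tconst c = tconst (c ^+ #|F|) * tau.
Proof.
change (tmul 'X c%:P = tmul (c ^+ #|F|)%:P 'X).
rewrite (@tmulE 2) ?size_polyX // (@tmulE 1) ?size_polyC_leq1 //.
rewrite !big_ord_recl !big_ord0 /= !coefX !coefC /= scale0r scale1r add0r.
rewrite !addr0 map_polyC map_polyX /= /frobq expn1 expr1 expr0 mulr1.
by rewrite mul_polyC.
Qed.

(* The action of \sum_k c_k tau^k on L. *)
Definition tact (f : tpoly gamma) (x : L) : L :=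
  \sum_(k < size (f : {poly L})) (f : {poly L})`_k * x ^+ (#|F| ^ k)%N.

(* Rank 2 Drinfeld A-modules over L; the second field is F-linearity. *)
Record drinfeld2 := Drinfeld2 {
  drinfeld_map :> {rmorphism {poly F} -> tpoly gamma};
  drinfeld_const : forall c : F, drinfeld_map c%:P = tconst (gamma c%:P);
  drinfeld_T : exists Delta g : L, Delta != 0 /\
    drinfeld_map 'X = tconst Delta * tau ^+ 2 + tconst g * tau
                      + tconst (gamma 'X)
}.

Definition supersingular (p : {poly F}) (psi : drinfeld2) : Prop :=
  [set x : L | tact (psi p) x = 0]%classic = [set 0]%classic.

Definition scalarF : {rmorphism F -> tpoly gamma} :=
  (tconst \o (gamma \o polyC))%FUN.

Lemma comm_scalarF (a b c : L) : commr_rmorph scalarF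
  (tconst a * tau ^+ 2 + tconst b * tau + tconst c).
Proof.
move=> x /=; pose y := tconst (gamma x%:P).
have cC d : GRing.comm y (tconst d).
  by rewrite /GRing.comm -!rmorphM mulrC.
have cT : GRing.comm y tau.
  by rewrite /GRing.comm tau_const -rmorphXn -rmorphXn expf_card.
apply: commr_sym; do ![apply: commrD | apply: commrM | apply: commrX] => //.
Qed.

Definition psi_T (Delta : L) : tpoly gamma :=
  tconst Delta * tau ^+ 2 + tconst (- (Delta + gamma 'X)) * tau
  + tconst (gamma 'X).

Lemma psi_TE (Delta : L) :
  psi_T Delta = (tconst Delta * tau - tconst (gamma 'X)) * (tau - 1).
Proof.
rewrite mulrBr mulr1 mulrBl -mulrA -expr2 /psi_T rmorphN rmorphD mulNr mulrDl.
by rewrite !opprD opprK !addrA; congr (_ + _); exact: addrAC.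
Qed.

(* psi^Delta : evaluation of a(T) at T := psi^Delta_T. *)
Definition psi_map (Delta : L) : {rmorphism {poly F} -> tpoly gamma} :=
  horner_morph (comm_scalarF Delta (- (Delta + gamma 'X)) (gamma 'X)).

Fact psi_const (Delta : L) (c : F) :
  psi_map Delta c%:P = tconst (gamma c%:P).
Proof. by rewrite /psi_map /= horner_morphC. Qed.

Fact psi_mapT (Delta : L) : psi_map Delta 'X = psi_T Delta.
Proof. by rewrite /psi_map /= horner_morphX. Qed.

Fact psi_rank2 (Delta : L) : Delta != 0 -> exists Delta' g : L, Delta' != 0 /\
  psi_map Delta 'X = tconst Delta' * tau ^+ 2 + tconst g * tau
                     + tconst (gamma 'X).
Proof.
by move=> nz; exists Delta, (- (Delta + gamma 'X)); rewrite psi_mapT.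
Qed.

Definition psi (Delta : L) (nz : Delta != 0) : drinfeld2 :=
  Drinfeld2 (psi_const Delta) (psi_rank2 nz).

Definition supersingular_Delta (p : {poly F}) : set L :=
  [set Delta : L | exists nz : Delta != 0, supersingular p (psi nz)]%classic.

(* The product is over a finite set. For an infinite set this operator would
   return 1. *)
Definition deuring (p : {poly F}) : {poly L} :=
  \big[*%R/1]_(Delta \in supersingular_Delta p) ('X - Delta%:P).

End TwistedPolynomials.

(* In A[s] = {poly {poly F}}, 'X is s and ('X)%:P is the variable T of A.
   The value 0 of u_pred at i = 0 is u_(-1). *)
Fixpoint u_poly (F : finFieldType) (n : nat) : {poly {poly F}} :=
  match n with
  | 0%N => 1
  | i.+1 =>
      let q := #|F| in
      let u_pred := match i with 0%N => 0 | j.+1 => u_poly F j end in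
      ('X + ('X ^+ q)%:P) ^+ (q ^ i)%N * u_poly F i
      - ('X ^+ (q ^ i)%N - 'X)%:P * 'X ^+ (q ^ i)%N * u_pred
  end.

(* Main.v *)
Require Import Defs.
From mathcomp Require Import all_boot all_order all_fingroup all_solvable.
From mathcomp Require Import all_algebra all_field.
From mathcomp Require Import classical_sets fsbigop.
From mathcomp Require Import ring.

Set Implicit Arguments.
Unset Strict Implicit.
Unset Printing Implicit Defensive.

Import GRing.Theory.
Local Open Scope ring_scope.

(** Write [t = gamma 'X], [q = #|F|], [[j] = t^(q^j) - t], and let [U i] be the
    image of [u_i] in [L[s]]. Two facts have to be shown: the supersingular
    parameters are the roots of [U d], and [U d], which is monic, has only simple
    roots.

    The recursion for [u_i] is that of the coefficients of the logarithm of the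
    module [(tau - 1)(D tau - T)], which [tau - 1] makes isogenous to
    [psi^D = (D tau - T)(tau - 1)]: in generic characteristic this logarithm is
    [sum_i u_i(D) / ([1] ... [i]) tau^i]. In [A]-characteristic [p] its denominators
    vanish from [i = d] on, but its terms of index less than [d] survive, and
    composing them with [tau - 1], after clearing denominators, gives [mu] with
    [mu psi_T = t mu + U_d(D) tau^d] modulo [tau^(d+1)] ([truncated_log]). Since
    [t] is fixed by the [q^d]-power map, [tau^d psi_T = t tau^d] modulo
    [tau^(d+1)], and so
    [mu psi_a = gamma(a) mu + gamma(a') U_d(D) tau^d] modulo the same, for all [a]
    ([psi_mod_tau]). For [a = p] the first term vanishes while [gamma(p')] does
    not, because [p] is separable. Hence the coefficients of [psi_p] below [tau^d]
    vanish and that of [tau^d] is a nonzero multiple of [U_d(D)]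
    ([psi_p_low_coefs]).

    If this coefficient is zero, then the lowest nonzero coefficient of [psi_p],
    say of index [k], satisfies [t^(q^k) = t] because [psi_p] commutes with
    [psi_T]; hence [d] divides [k], so [psi_p] is a constant times [tau^(2d)]
    and acts injectively. If it is nonzero, [psi_p] has two nonzero coefficients, of
    indices [d] and [2d], and so a nonzero root ([tact_inj_monomial],
    [supersingularP]).

    Simplicity of the roots comes from differentiating the recursion with respect
    to [s]: the factors that are [q^i]-th powers, [i > 0], are constants for the
    derivation, so that [U i] and [U' i] satisfy the same second order recursion.
    Their Casoratian is therefore an explicit product, a nonzero constant times a
    power of [s] ([casoratian_ubar]), and [U d] does not vanish at [0] because
    [p] is not associate to [T]. *)

(** * The q-power Frobenius of L *)

Section Frobenius.

Variables (F : finFieldType) (L : fieldType) (gamma : {rmorphism {poly F} -> L}).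
Local Notation q := #|F|.
Local Notation t := (gamma 'X).

Lemma exprqD i (x y : L) : (x + y) ^+ (q ^ i)%N = x ^+ (q ^ i)%N + y ^+ (q ^ i)%N.
Proof. exact: (rmorphD (frobq gamma i)). Qed.

Lemma expr0q i : (0 : L) ^+ (q ^ i)%N = 0.
Proof. exact: (rmorph0 (frobq gamma i)). Qed.

Lemma exprq_inj i : injective (fun x : L => x ^+ (q ^ i)%N).
Proof. exact: (fmorph_inj (frobq gamma i)). Qed.

Lemma natr_cardq i : (q ^ i.+1)%:R = 0 :> L.
Proof.
have rq : pdiv q \in \pi(q) by rewrite pi_pdiv finNzRing_gt1.
have := pnat_frobq gamma 1; rewrite expn1 => /pnatPpi/(_ rq) rL.
by apply/eqP; rewrite -(dvdn_pcharf rL) expnS dvdn_mulr ?pdiv_dvd.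
Qed.

Lemma expr_cardX (c : F) i : c ^+ (q ^ i)%N = c.
Proof. by elim: i => [|i IH]; rewrite ?expr1 // expnSr exprM IH expf_card. Qed.

Lemma exprq_const (c : F) i : gamma c%:P ^+ (q ^ i)%N = gamma c%:P.
Proof. by rewrite -!rmorphXn /= expr_cardX. Qed.

Lemma gammaMXaddC (a : {poly F}) (c : F) :
  gamma (a * 'X + c%:P) = gamma a * t + gamma c%:P.
Proof. by rewrite rmorphD rmorphM. Qed.

(** The coefficients of [a] are fixed by the Frobenius, so [gamma a] is the
    value at [t] of a polynomial that commutes with it. *)
Lemma exprq_gamma (a : {poly F}) i :
  gamma a ^+ (q ^ i)%N = (map_poly (gamma \o polyC) a).[t ^+ (q ^ i)%N].
Proof.
elim/poly_ind: a => [|a c IH]; first by rewrite !rmorph0 horner0 expr0q.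
rewrite gammaMXaddC exprqD exprMn IH exprq_const rmorphD rmorphM /=.
by rewrite map_polyX map_polyC /= !hornerE.
Qed.

End Frobenius.

(** * The residue field F[T]/p inside L *)

Section ResidueField.

Variables (F : finFieldType) (L : fieldType) (gamma : {rmorphism {poly F} -> L}).
Variables (p : {poly F}) (d : nat).
Hypothesis size_p : size p = d.+1.
Hypothesis ker_gamma : forall a : {poly F}, (gamma a == 0) = (p %| a).
Local Notation q := #|F|.
Local Notation t := (gamma 'X).

Let q_gt1 : (1 < q)%N := finNzRing_gt1 F.

Lemma gamma_small_neq0 (a : {poly F}) : a != 0 -> (size a <= d)%N -> gamma a != 0.
Proof.
move=> a0 sa; rewrite ker_gamma; apply/negP => /(dvdp_leq a0).
by rewrite size_p leqNgt ltnS sa.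
Qed.

(** If the [q^j]-Frobenius fixes [t], it fixes the [q^d] distinct values of
    [gamma] on polynomials of degree less than [d]; these are too many roots for
    [X^(q^j) - X] when [j < d]. *)
Lemma exprq_fix_geq j : (0 < j)%N -> t ^+ (q ^ j)%N = t -> (d <= j)%N.
Proof.
move=> j0 tj.
have fixa a : gamma a ^+ (q ^ j)%N = gamma a.
  by rewrite exprq_gamma tj -[in RHS](expr1 (gamma a)) -(expn0 q) exprq_gamma expr1.
have qj1 : (1 < q ^ j)%N by rewrite -(expn0 q) ltn_exp2l.
have sP : size ('X^(q ^ j) - 'X : {poly L}) = (q ^ j).+1.
  by rewrite size_polyDl size_polyXn // size_polyN size_polyX ltnS.
pose rs := [seq gamma (rVpoly v) | v <- enum 'rV[F]_d].
have: (size rs < size ('X^(q ^ j) - 'X : {poly L})%R)%N.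
  apply: max_poly_roots; first by rewrite -size_poly_eq0 sP.
    apply/allP => _ /mapP[v _ ->].
    by rewrite /root !hornerE fixa subrr.
  rewrite map_inj_uniq ?enum_uniq // => v w /eqP.
  rewrite -subr_eq0 -rmorphB /= => h.
  case: (eqVneq (rVpoly v) (rVpoly w)) => [/(can_inj rVpolyK) //|].
  rewrite -subr_eq0 => nz.
  have /(gamma_small_neq0 nz): (size (rVpoly v - rVpoly w)%R <= d)%N.
    by rewrite (leq_trans (size_polyD _ _)) // size_polyN geq_max !size_poly.
  by rewrite h.
by rewrite sP size_map -cardE card_mx mul1n ltnS leq_exp2l.
Qed.

(** The powers [t^(q^i)], [i <= d], are all roots of the image of [p], so two of
    them coincide. As the Frobenius is injective, it follows that
    [t^(q^k) = t] for some [0 < k <= d], and [exprq_fix_geq] forces [k = d]. *)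
Lemma exprq_degree : t ^+ (q ^ d)%N = t.
Proof.
pose rs := [seq t ^+ (q ^ i)%N | i : 'I_d.+1].
pose P := map_poly (gamma \o polyC) p.
have sP : size P = d.+1 by rewrite size_map_poly.
have P0 : P != 0 by rewrite -size_poly_eq0 sP.
have rootP : all (root P) rs.
  apply/allP => _ /mapP[i _ ->]; rewrite /root -exprq_gamma.
  have /eqP -> : gamma p == 0 by rewrite ker_gamma dvdpp.
  by rewrite (expr0q gamma).
have : ~~ uniq rs.
  apply/negP => /(max_poly_roots P0 rootP).
  by rewrite sP size_map size_enum_ord ltnn.
rewrite -/(injectiveb _) => /injectivePn[i [j ij]].
have aux (m n : 'I_d.+1) : (m < n)%N -> t ^+ (q ^ m)%N = t ^+ (q ^ n)%N ->
    t ^+ (q ^ d)%N = t.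
  move=> mn; rewrite -(subnK (ltnW mn)) expnD exprM.
  move=> /(exprq_inj gamma)/esym h.
  suff <- : (n - m)%N = d by [].
  apply/eqP; rewrite eqn_leq exprq_fix_geq ?subn_gt0 // andbT.
  by rewrite leq_subLR (leq_trans (ltn_ord n : n <= d)%N) // leq_addl.
case: (ltngtP i j) ij => [ij _|ji _|/val_inj -> /eqP //]; first exact: aux.
by move/esym; exact: aux.
Qed.

(** [p] divides [X^(q^d) - X], whose derivative is [-1]; so [p] is separable. *)
Lemma gamma_deriv_neq0 : (0 < d)%N -> gamma p^`() != 0.
Proof.
move=> d0; apply/negP => /eqP dp0.
have : p %| 'X^(q ^ d) - 'X.
  by rewrite -ker_gamma rmorphB rmorphXn exprq_degree subrr.
case/dvdpP => r /(congr1 (fun a => gamma a^`())).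
rewrite derivM derivB derivXn derivX -mulr_natr !(rmorphD, rmorphM) /= rmorphN dp0.
have /eqP -> : gamma p == 0 by rewrite ker_gamma dvdpp.
rewrite !mulr0 addr0 rmorph_nat -(prednK d0) (natr_cardq gamma) mulr0 add0r.
by rewrite rmorph1 => /eqP; rewrite oppr_eq0 oner_eq0.
Qed.

End ResidueField.

(** * The reductions of the polynomials u_i *)

Section Recursion.

Variables (F : finFieldType) (L : fieldType) (gamma : {rmorphism {poly F} -> L}).
Local Notation q := #|F|.
Local Notation t := (gamma 'X).

Definition bracket i : L := t ^+ (q ^ i)%N - t.

Definition ubar i : {poly L} := map_poly gamma (u_poly F i).

Lemma ubar0 : ubar 0 = 1.
Proof. exact: rmorph1. Qed.

Lemma ubar1 : ubar 1 = 'X + (t ^+ q)%:P.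
Proof.
rewrite /ubar /= expn0 !expr1 subrr mulr1 mulr0 subr0 rmorphD /=.
by rewrite map_polyX map_polyC /= rmorphXn.
Qed.

Lemma ubarSS i : ubar i.+2 = ('X + (t ^+ q)%:P) ^+ (q ^ i.+1)%N * ubar i.+1
  - (bracket i.+1)%:P * 'X ^+ (q ^ i.+1)%N * ubar i.
Proof.
rewrite /ubar; have -> : u_poly F i.+2 = ('X + ('X ^+ q)%:P) ^+ (q ^ i.+1)%N * u_poly F i.+1
  - ('X ^+ (q ^ i.+1)%N - 'X)%:P * 'X ^+ (q ^ i.+1)%N * u_poly F i by [].
move: (u_poly F i.+1) (u_poly F i) => u v.
rewrite rmorphB !rmorphM /= 2!rmorphXn rmorphD /= map_polyX !map_polyC /=.
by rewrite rmorphB !rmorphXn /= map_polyC map_polyX.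
Qed.

(** The growth of the degrees is part of the induction: it makes the first term
    of the recursion dominate the second. *)
Lemma monic_ubar i : ubar i \is monic.
Proof.
suff: [/\ ubar i \is monic, ubar i.+1 \is monic & (size (ubar i) < size (ubar i.+1))%N].
  by case.
elim: i => [|i [mi mi1 lt_i]].
  by rewrite ubar0 ubar1 monic1 monicXaddC size_XaddC size_poly1.
pose A := ('X + (t ^+ q)%:P) ^+ (q ^ i.+1)%N * ubar i.+1.
have mX : ('X + (t ^+ q)%:P) ^+ (q ^ i.+1)%N \is monic.
  by rewrite monic_exp ?monicXaddC.
have mA : A \is monic by rewrite monicMl.
have sA : size A = (q ^ i.+1 + size (ubar i.+1))%N.
  by rewrite size_monicM ?monic_neq0 // -[(t ^+ q)%:P]opprK -polyCN size_exp_XsubC.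
have lt_A : (size (- ((bracket i.+1)%:P * 'X ^+ (q ^ i.+1)%N * ubar i))%R < size A)%N.
  rewrite size_polyN -mulrA mul_polyC (leq_ltn_trans (size_scale_leq _ _)) //.
  by rewrite mulrC size_mulXn ?monic_neq0 // sA ltn_add2l.
split=> //; rewrite ubarSS; first by rewrite monicE lead_coefDl // -monicE.
rewrite size_polyDl // sA -[ltnLHS]add0n ltn_add2r expn_gt0.
by rewrite (ltnW (finNzRing_gt1 F)).
Qed.

Lemma ubar_horner0 i : (ubar i).[0] = \prod_(j < i) t ^+ (q ^ j.+1)%N.
Proof.
elim: i => [|[|i] IH]; first by rewrite big_ord0 ubar0 hornerC.
  by rewrite big_ord1 ubar1 !hornerE expn1.
rewrite big_ord_recr /= -IH ubarSS !hornerE (expr0q gamma).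
by rewrite mulr0 mul0r subr0 -exprM -expnS mulrC.
Qed.

Lemma deriv_exprq (P : {poly L}) i : (P ^+ (q ^ i.+1)%N)^`() = 0.
Proof. by rewrite deriv_exp -mulr_natr -polyC_natr (natr_cardq gamma) mulr0. Qed.

Lemma deriv_ubarSS i : (ubar i.+2)^`() =
  ('X + (t ^+ q)%:P) ^+ (q ^ i.+1)%N * (ubar i.+1)^`()
  - (bracket i.+1)%:P * 'X ^+ (q ^ i.+1)%N * (ubar i)^`().
Proof.
by rewrite ubarSS derivB !derivM !deriv_exprq derivC !(mul0r, mulr0, add0r).
Qed.

(** Two solutions of a recursion [x_(i+2) = a_i x_(i+1) - b_i x_i] have a
    Casoratian that is multiplied by [b_i] at each step. *)
Lemma casoratian_ubar i :
  (ubar i.+1)^`() * ubar i - ubar i.+1 * (ubar i)^`() =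
  \prod_(1 <= j < i.+1) ((bracket j)%:P * 'X ^+ (q ^ j)%N).
Proof.
elim: i => [|i IH].
  by rewrite big_geq // ubar0 ubar1 derivD derivX !derivC mulr0 mulr1 addr0 subr0.
rewrite big_nat_recr //= -IH deriv_ubarSS ubarSS.
move: ((ubar i)^`()) ((ubar i.+1)^`()) (ubar i) (ubar i.+1) => v' u' v u.
by ring.
Qed.

(** A common factor of [U d] and its derivative divides the Casoratian, hence is a
    power of [s] up to a constant. *)
Lemma separable_ubar d : t != 0 -> (0 < d)%N ->
  (forall j, (0 < j < d)%N -> bracket j != 0) -> separable_poly (ubar d).
Proof.
case: d => // d t0 _ bracket0.
have copX i : coprimep (ubar d.+1) ('X ^+ (q ^ i)%N).
  apply: coprimep_expr; rewrite -['X]subr0 -polyC0 coprimep_XsubC /root ubar_horner0.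
  by apply/prodf_neq0 => j _; rewrite expf_neq0.
have : coprimep (ubar d.+1) (ubar d.+1 * - (ubar d)^`() + (ubar d.+1)^`() * ubar d).
  rewrite mulrN addrC casoratian_ubar big_nat_cond.
  apply: (big_ind (coprimep _)) => [|P Q cP cQ|j]; first exact: coprimep1.
    by rewrite coprimepMr cP.
  by rewrite andbT => /bracket0 bj; rewrite mul_polyC coprimepZr.
by rewrite mulrC coprimep_addl_mul coprimepMr unlock => /andP[].
Qed.

End Recursion.

(** * Coefficients of twisted polynomials *)

Section TwistedCoefficients.

Variables (F : finFieldType) (L : fieldType) (gamma : {rmorphism {poly F} -> L}).
Local Notation q := #|F|.
Local Notation R := (tpoly gamma).

(** A twisted polynomial and its underlying polynomial multiply differently; a
    separate coefficient function keeps the two ring structures apart. *)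
Definition tcoef (f : R) k : L := (f : {poly L})`_k.

Lemma tcoefD f g k : tcoef (f + g) k = tcoef f k + tcoef g k.
Proof. exact: coefD. Qed.

Lemma tcoefN f k : tcoef (- f) k = - tcoef f k.
Proof. exact: coefN. Qed.

Lemma tcoef0 k : tcoef 0 k = 0.
Proof. exact: coef0. Qed.

Lemma tcoef_const c k : tcoef (tconst gamma c) k = if k is 0 then c else 0.
Proof. by rewrite /tcoef /tconst coefC; case: k. Qed.

Lemma tcoefM f g k :
  tcoef (f * g) k = \sum_(i < k.+1) tcoef f i * tcoef g (k - i) ^+ (q ^ i)%N.
Proof.
change ((tmul gamma f g)`_k = \sum_(i < k.+1) (f : {poly L})`_i * (g : {poly L})`_(k - i) ^+ (q ^ i)%N).
rewrite (@tmulE _ _ _ (size (f : {poly L}) + k.+1)) ?leq_addr // coef_sum.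
pose G i := (f : {poly L})`_i * (map_poly (frobq gamma i) (g : {poly L}) * 'X^i)`_k.
rewrite (eq_bigr (fun i : 'I_(_) => G i)); last by move=> i _; rewrite coefZ.
rewrite addnC big_split_ord /= [X in _ + X]big1 ?addr0; last first.
  by move=> i _; rewrite /G coefMXn ltnS leq_addr mulr0.
by apply: eq_bigr => i _; rewrite /G coefMXn ltnNge -ltnS ltn_ord /= coef_map.
Qed.

Lemma tcoef_mul_const f c k : tcoef (f * tconst gamma c) k = tcoef f k * c ^+ (q ^ k)%N.
Proof.
rewrite tcoefM big_ord_recr /= subnn tcoef_const big1 ?add0r // => i _.
rewrite tcoef_const; case E: (k - i)%N => [|j]; last by rewrite (expr0q gamma) mulr0.
by move/eqP: E; rewrite subn_eq0 leqNgt ltn_ord.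
Qed.

Lemma tcoef_mul_tau f k : tcoef (f * tau gamma) k = if k is k'.+1 then tcoef f k' else 0.
Proof.
change ((tmul gamma f 'X)`_k = if k is k'.+1 then (f : {poly L})`_k' else 0).
have -> : tmul gamma f 'X = (f : {poly L}) * 'X.
  rewrite /tmul -[in RHS](coefK (f : {poly L})) poly_def mulr_suml.
  by apply: eq_bigr => i _; rewrite map_polyX -scalerAl mulrC commr_polyX.
by rewrite coefMX; case: k.
Qed.

Lemma tcoefM_lowl f g k : (forall i, (i < k)%N -> tcoef f i = 0) ->
  tcoef (f * g) k = tcoef f k * tcoef g 0 ^+ (q ^ k)%N.
Proof.
move=> f0; rewrite tcoefM big_ord_recr /= subnn big1 ?add0r // => i _.
by rewrite f0 // mul0r.
Qed.

Lemma tcoefM_lowr f g k : (forall i, (i < k)%N -> tcoef f i = 0) ->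
  tcoef (g * f) k = tcoef g 0 * tcoef f k.
Proof.
move=> f0; rewrite tcoefM big_ord_recl /= subn0 expn0 expr1 big1 ?addr0 // => i _.
by rewrite f0 ?(expr0q gamma) ?mulr0 // /bump /= add1n -subn_gt0 subKn.
Qed.

Lemma tact_tcoef f x N : (forall k, (N <= k)%N -> tcoef f k = 0) ->
  tact f x = \sum_(k < N) tcoef f k * x ^+ (q ^ k)%N.
Proof.
move=> f0; have leN : (size (f : {poly L}) <= N)%N by apply/leq_sizeP.
rewrite /tact (big_ord_widen _ (fun k => (f : {poly L})`_k * x ^+ (q ^ k)%N) leN).
rewrite big_mkcond; apply: eq_bigr => i _ /=; rewrite /tcoef.
by case: ltnP => // le_i; rewrite (nth_default _ le_i) mul0r.
Qed.

End TwistedCoefficients.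

(** * The kernel of a twisted polynomial acting on L *)

Section TwistedKernel.

Variables (F : finFieldType) (L : closedFieldType).
Variable gamma : {rmorphism {poly F} -> L}.
Local Notation q := #|F|.

(** The action is by a polynomial in which distinct indices give distinct
    exponents [q^k]; over an algebraically closed field, a polynomial with no root
    but [0] is a monomial. *)
Lemma tact_inj_monomial (f : tpoly gamma) i j :
  (forall x, tact f x = 0 -> x = 0) -> tcoef f i != 0 -> tcoef f j != 0 -> i = j.
Proof.
move=> f_inj.
pose Q : {poly L} := \sum_(k < size (f : {poly L})) tcoef f k *: 'X^(q ^ k).
have coefQ k : Q`_(q ^ k) = tcoef f k.
  rewrite coef_sum (eq_bigr (fun i : 'I_(size (f : {poly L})) =>
    if k == i :> nat then tcoef f i else 0)); last first.
    by move=> l _; rewrite coefZ coefXn eqn_exp2l ?finNzRing_gt1 // mulr_natr mulrb.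
  case: (ltnP k (size (f : {poly L}))) => [lt_k|le_k].
    rewrite (bigD1 (Ordinal lt_k)) //= eqxx big1 ?addr0 // => l ne.
    by case: eqP => // e; case/eqP: ne; apply: val_inj.
  rewrite big1 => [|l _]; first by rewrite /tcoef nth_default.
  by case: eqP le_k => // ->; rewrite leqNgt ltn_ord.
have hornerQ x : Q.[x] = tact f x.
  by rewrite horner_sum; apply: eq_bigr => k _; rewrite !hornerE.
have [rs defQ] := closed_field_poly_normal Q.
have [n Qn] : exists n, Q = lead_coef Q *: 'X^n.
  exists (size rs); rewrite [LHS]defQ; congr (_ *: _).
  rewrite big_seq (eq_bigr (fun=> 'X)); first by rewrite -big_seq big_const_seq
    count_predT; elim: (size rs) => //= m ->; rewrite exprS.
  move=> x xrs; have -> : x = 0; last by rewrite polyC0 subr0.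
  apply: f_inj; rewrite -hornerQ defQ hornerZ.
  have /rootP -> : root (\prod_(z <- rs) ('X - z%:P)) x by rewrite root_prod_XsubC.
  by rewrite mulr0.
have only_n k : tcoef f k != 0 -> (q ^ k)%N = n.
  by rewrite -coefQ Qn coefZ coefXn; case: (_ =P n) => // _; rewrite mulr0 eqxx.
move=> /only_n ei /only_n/eqP; rewrite -ei eqn_exp2l ?finNzRing_gt1 //.
by move/eqP->.
Qed.

End TwistedKernel.

(** * The truncated logarithm of psi^D *)

Section PsiDelta.

Variables (F : finFieldType) (L : fieldType) (gamma : {rmorphism {poly F} -> L}).
Variable D : L.
Local Notation q := #|F|.
Local Notation t := (gamma 'X).
Local Notation psiD := (psi_map gamma D).

Lemma psi_mapMXaddC (a : {poly F}) (c : F) :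
  psiD (a * 'X + c%:P) = psiD a * psi_T gamma D + tconst gamma (gamma c%:P).
Proof. by rewrite rmorphD rmorphM /= psi_mapT psi_const. Qed.

Lemma tcoef_mul_psiT f k : tcoef (f * psi_T gamma D) k.+2 =
  tcoef f k * D ^+ (q ^ k)%N + tcoef f k.+1 * (- (D + t)) ^+ (q ^ k.+1)%N
  + tcoef f k.+2 * t ^+ (q ^ k.+2)%N.
Proof.
rewrite /psi_T expr2 !mulrDr !mulrA !tcoefD.
by rewrite !(tcoef_mul_tau, tcoef_mul_const).
Qed.

Lemma tcoef0_psiT : tcoef (psi_T gamma D) 0 = t.
Proof.
by rewrite /psi_T expr2 mulrA !tcoefD !tcoef_mul_tau tcoef_const !add0r.
Qed.

Lemma tcoef_psi_top (a : {poly F}) : D != 0 -> a != 0 ->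
  tcoef (psiD a) (size a).-1.*2 != 0 /\
  (forall k, ((size a).-1.*2 < k)%N -> tcoef (psiD a) k = 0).
Proof.
move=> D0; elim/poly_ind: a => [|a c IH]; first by rewrite eqxx.
rewrite psi_mapMXaddC; case: (eqVneq a 0) => [->|a0 _].
  rewrite mul0r rmorph0 mul0r !add0r polyC_eq0 size_polyC => c0.
  have gc0 : gamma c%:P != 0 by rewrite (fmorph_eq0 (gamma \o polyC)).
  by rewrite c0 /= tcoef_const; split => // -[|k] //; rewrite tcoef_const.
have [top0 gt_top] := IH a0.
have sa : (0 < size a)%N by rewrite size_poly_gt0.
rewrite size_MXaddC (negPf a0) /= -(prednK sa) doubleS.
split=> [|[|[|k]] // lt_k].
  rewrite tcoefD tcoef_const addr0 tcoef_mul_psiT !(gt_top _.+1) ?ltnS ?leqnSn ?leqnn //.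
  by rewrite !mul0r !addr0 mulf_neq0 // expf_neq0.
rewrite tcoefD tcoef_const addr0 tcoef_mul_psiT.
by rewrite gt_top // !gt_top ?mul0r ?addr0 // ltnW // ltnW.
Qed.

(** Compare the lowest coefficients of the two sides of
    [psi_a psi_T = psi_T psi_a]. *)
Lemma psi_low_coef (a : {poly F}) k :
  (forall i, (i < k)%N -> tcoef (psiD a) i = 0) -> tcoef (psiD a) k != 0 ->
  t ^+ (q ^ k)%N = t.
Proof.
move=> low nz; apply: (mulfI nz).
rewrite -{1}tcoef0_psiT -(tcoefM_lowl _ low) mulrC -tcoef0_psiT -(tcoefM_lowr _ low).
by rewrite -psi_mapT -!rmorphM mulrC.
Qed.

(** Modulo [tau^(d+1)], right multiplication by [psi_T] acts on the span of [mu]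
    and [tau^d] as [t] plus the nilpotent map sending [mu] to [m tau^d]; applying
    [a] to such an operator produces the derivative of [a]. *)
Lemma psi_mod_tau (mu : tpoly gamma) (m : L) d : t ^+ (q ^ d)%N = t ->
  (forall k, (k <= d)%N ->
     tcoef (mu * psi_T gamma D) k = t * tcoef mu k + m *+ (k == d)) ->
  forall a k, (k <= d)%N ->
    tcoef (mu * psiD a) k = gamma a * tcoef mu k + gamma a^`() * m *+ (k == d).
Proof.
move=> td muT; elim/poly_ind=> [|a c IH] k le_k.
  by rewrite deriv0 !rmorph0 mulr0 tcoef0 !mul0r mul0rn addr0.
rewrite psi_mapMXaddC mulrDr mulrA tcoefD tcoef_mul_const exprq_const.
move: (mu * psiD a) IH => h IH.
have -> : tcoef (h * psi_T gamma D) k =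
    gamma a * tcoef (mu * psi_T gamma D) k + gamma a^`() * m * t *+ (k == d).
  rewrite !tcoefM !big_ord_recr /= subnn IH // mulrDl mulrDr tcoef0_psiT -mulrA addrA.
  congr (_ + _ + _).
    rewrite mulr_sumr; apply: eq_bigr => i _; have lt_i := leq_trans (ltn_ord i) le_k.
    by rewrite IH ?(ltnW lt_i) // (ltn_eqF lt_i) mulr0n addr0 mulrA.
  by case: eqP => [->|_]; rewrite ?td // !mulr0n mul0r.
rewrite muT // derivD derivM derivX derivC mulr1 addr0 gammaMXaddC rmorphD rmorphM /=.
by case: eqP => _; rewrite ?mulr1n ?mulr0n; ring.
Qed.

(** The witness is [lam (tau - 1)], where [lam] has for coefficients those of the
    logarithm, [u_k(D) / ([1] ... [k])], multiplied by [[1] ... [d-1]] to avoid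
    divisions. *)
Lemma truncated_log d : (0 < d)%N -> t ^+ (q ^ d)%N = t ->
  exists2 mu : tpoly gamma, tcoef mu 0 = - \prod_(1 <= j < d) bracket gamma j &
    forall k, (k <= d)%N -> tcoef (mu * psi_T gamma D) k =
      t * tcoef mu k + (ubar gamma d).[D] *+ (k == d).
Proof.
move=> d0 td; pose P k := \prod_(k <= j < d) bracket gamma j.
pose u k := (ubar gamma k).[D].
pose l k := if (k < d)%N then u k * P k.+1 else 0.
pose lam : tpoly gamma := (\poly_(k < d) (u k * P k.+1) : {poly L}).
have lamE k : tcoef lam k = l k by rewrite /tcoef coef_poly.
pose mu := lam * (tau gamma - 1).
have mulB1 f k : tcoef (f * (tau gamma - 1)) k =
    (if k is k'.+1 then tcoef f k' else 0) - tcoef f k.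
  by rewrite mulrBr mulr1 tcoefD tcoefN tcoef_mul_tau.
have P_rec k : (k < d)%N -> P k = bracket gamma k * P k.+1.
  by move=> lt_k; rewrite /P big_ltn.
have recl k : (k < d)%N -> l k * t ^+ (q ^ k)%N - u k * P k = t * l k.
  by move=> lt_k; rewrite /l lt_k (P_rec k) // /bracket; ring.
(* Since psi^D = (D tau - t)(tau - 1), this is lam phi_T for the isogenous
   module phi_T = (tau - 1)(D tau - t). *)
pose h := mu * (tconst gamma D * tau gamma - tconst gamma t).
(* At k = d the term l d is cut off while the recursion still produces u d:
   this is where the polynomial U d enters. *)
have hE k : (k <= d)%N -> tcoef h k = t * l k - u d *+ (k == d).
  move=> le_k; have -> : tcoef h k = l k * t ^+ (q ^ k)%N - u k * P k *+ (0 < k)%N.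
    rewrite /h mulrBr mulrA tcoefD tcoefN tcoef_mul_tau !tcoef_mul_const.
    case: k le_k => [_|[|k] le_k].
    - by rewrite /mu mulB1 lamE mulr0n; ring.
    - rewrite tcoef_mul_const /mu !mulB1 !lamE /u ubar1 !hornerE /l d0 /u ubar0 hornerC.
      by rewrite expn0 expn1 expr1 mulr1n; ring.
    rewrite tcoef_mul_const /mu !mulB1 !lamE.
    rewrite [u k.+2]/u ubarSS !hornerE -/(u k) -/(u k.+1) (exprqD gamma) -exprM -expnS.
    by rewrite mulr1n /l le_k (ltnW le_k) (P_rec k.+1) //; ring.
  case: (ltngtP k d) le_k => // [lt_k _|-> _].
    rewrite subr0; case: k lt_k => [_|k lt_k]; last by rewrite mulr1n recl.
    by rewrite expn0 expr1 subr0 mulrC.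
  by rewrite d0 /l ltnn /P big_geq // mulr1 mulr0 mul0r.
exists mu.
  by rewrite /mu mulB1 lamE /l d0 /u ubar0 hornerC sub0r mul1r.
move=> k le_k; rewrite psi_TE mulrA mulB1 -/h hE // /mu mulB1 !lamE.
case: k le_k => [|k] le_k; first by rewrite ltn_eqF // !mulr0n; ring.
rewrite hE ?(ltnW le_k) // (ltn_eqF le_k) mulr0n /u.
by rewrite lamE; case: (k.+1 == d); rewrite ?mulr1n ?mulr0n; ring.
Qed.

End PsiDelta.

(** * Supersingular parameters *)

Section Supersingular.

Variables (F : finFieldType) (L : closedFieldType).
Variable gamma : {rmorphism {poly F} -> L}.
Variables (p : {poly F}) (d : nat).
Hypothesis size_p : size p = d.+1.
Hypothesis d_gt0 : (0 < d)%N.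
Hypothesis ker_gamma : forall a : {poly F}, (gamma a == 0) = (p %| a).
Local Notation q := #|F|.
Local Notation t := (gamma 'X).

Lemma bracket_neq0 j : (0 < j < d)%N -> bracket gamma j != 0.
Proof.
case/andP=> j0; apply: contraL; rewrite subr_eq0 -leqNgt => /eqP.
exact: (exprq_fix_geq size_p ker_gamma).
Qed.

(** Evaluate [psi_mod_tau] at [p], where only the term in [tau^d] remains; the
    constant coefficient of [mu], a product of nonzero [[j]], can be cancelled. *)
Lemma psi_p_low_coefs D :
  (forall k, (k < d)%N -> tcoef (psi_map gamma D p) k = 0) /\
  (tcoef (psi_map gamma D p) d == 0) = root (ubar gamma d) D.
Proof.
have td := exprq_degree size_p ker_gamma.
have [mu mu0 muT] := truncated_log D d_gt0 td.
have gp0 : gamma p = 0 by apply/eqP; rewrite ker_gamma dvdpp.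
have mu0_neq0 : tcoef mu 0 != 0.
  rewrite mu0 oppr_eq0 prodf_seq_neq0; apply/allP => j.
  by rewrite mem_index_iota; exact: bracket_neq0.
have := psi_mod_tau td muT p; rewrite gp0.
move: (psi_map gamma D p) => f mu_f.
have low k : (k < d)%N -> tcoef f k = 0.
  elim/ltn_ind: k => k IH lt_k; apply: (mulfI mu0_neq0).
  rewrite -tcoefM_lowr => [|i lt_i]; last exact: IH lt_i (ltn_trans lt_i lt_k).
  by rewrite mu_f ?(ltnW lt_k) // (ltn_eqF lt_k) mul0r mulr0 addr0.
split=> //; rewrite -(mulrI_eq0 _ (mulfI mu0_neq0)) -(tcoefM_lowr _ low) mu_f //.
rewrite mul0r add0r eqxx mulr1n mulf_eq0.
by rewrite (negPf (gamma_deriv_neq0 size_p ker_gamma d_gt0)).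
Qed.

(** The leading coefficient of [psi_p], of index [2d], never vanishes; so [psi_p]
    has trivial kernel exactly when it is the only nonzero one, and commutation
    with [psi_T] leaves [d] as the only other possible lowest index. *)
Lemma supersingularP D (nz : D != 0) :
  supersingular p (psi gamma nz) <-> root (ubar gamma d) D.
Proof.
have [low <-] := psi_p_low_coefs D.
have p0 : p != 0 by rewrite -size_poly_eq0 size_p.
have [] := tcoef_psi_top gamma nz p0; rewrite size_p succnK => top0 gt_top.
have lt_d2 : (d < d.*2)%N by rewrite -addnn -[ltnLHS]addn0 ltn_add2l.
rewrite /supersingular -[drinfeld_map _ p]/(psi_map gamma D p).
have := @psi_low_coef _ _ gamma D p.
move: (psi_map gamma D p) low top0 gt_top => f low top0 gt_top low_fix.
have tactE x := @tact_tcoef _ _ _ f x d.*2.+1 gt_top.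
split=> [ss|/eqP fd0].
  apply/negPn/negP => fd; suff e : d = d.*2 by rewrite -{1}e ltnn in lt_d2.
  apply: (tact_inj_monomial (f := f)) => // x fx.
  have : [set x | tact f x = 0]%classic x by [].
  by rewrite ss.
(* An index k strictly between d and 2d would give t^(q^(k-d)) = t with
   0 < k - d < d. *)
have mid k : (k < d.*2)%N -> tcoef f k = 0.
  elim/ltn_ind: k => k IH lt_k; case: (ltngtP k d) => [|lt_dk|-> //]; first exact: low.
  apply/eqP/negPn/negP => /(low_fix _ (fun i lt_i => IH i lt_i (ltn_trans lt_i lt_k))).
  rewrite -(subnK (ltnW lt_dk)) expnD exprM -{2}(exprq_degree size_p ker_gamma).
  move/(exprq_inj gamma)/(exprq_fix_geq size_p ker_gamma).
  rewrite subn_gt0 lt_dk => /(_ isT).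
  by rewrite leqNgt ltn_subLR ?addnn ?lt_k // ltnW.
have tact_top x : tact f x = tcoef f d.*2 * x ^+ (q ^ d.*2)%N.
  rewrite tactE big_ord_recr /= big1 ?add0r // => i _.
  by rewrite mid // mul0r.
apply/seteqP; split=> x /=; rewrite tact_top.
  move/eqP; rewrite mulf_eq0 (negPf top0) /= expf_eq0 => /andP[_ /eqP //].
by move->; rewrite (expr0q gamma) mulr0.
Qed.

End Supersingular.

Unset Implicit Arguments.

Theorem theorem7 (F : finFieldType) (p : {poly F}) (d : nat)
    (L : closedFieldType) (gamma : {rmorphism {poly F} -> L})
    (p_irr : irreducible_poly p) (deg_p : size p = d.+1)
    (p_neqT : ~~ (p %= 'X))
    (L_closure : algebraic_closure_mod p gamma) :
  deuring gamma p = map_poly gamma (u_poly F d).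
Proof.
have [ker_gamma _] := L_closure.
have [p_gt1 p_div] := p_irr.
have d_gt0 : (0 < d)%N by rewrite deg_p in p_gt1.
have t_neq0 : gamma 'X != 0.
  rewrite ker_gamma; apply: contra p_neqT => pX.
  by rewrite -(dvdp_size_eqp pX) eqn_leq dvdp_leq ?polyX_eq0 // size_polyX.
rewrite -/(ubar gamma d).
have [rs def_u] := closed_field_poly_normal (ubar gamma d).
have mon_u := monic_ubar gamma d.
have {}def_u : ubar gamma d = \prod_(z <- rs) ('X - z%:P).
  by rewrite {1}def_u (eqP (mon_u : lead_coef _ == 1)) scale1r.
have uniq_rs : uniq rs.
  rewrite -separable_prod_XsubC -def_u; apply: separable_ubar => // j.
  exact: (bracket_neq0 deg_p).
have u0 : ~~ root (ubar gamma d) 0.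
  rewrite /root ubar_horner0; apply/prodf_neq0 => j _.
  by rewrite expf_neq0.
have ss_roots : supersingular_Delta gamma p = [set` rs]%classic.
  apply/seteqP; split=> D /=; rewrite -root_prod_XsubC -def_u.
    by case=> nz /(supersingularP deg_p d_gt0 ker_gamma).
  move=> rD; have nz : D != 0 by apply: contraNneq u0 => <-.
  by exists nz; apply/(supersingularP deg_p d_gt0 ker_gamma).
by rewrite /deuring ss_roots -fsbig_seq.
Qed.
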